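(* Let $\mathcal{R}$ be a cubicalizable category with thin-powered structure $\mathcal{R}^+_0$. Then there is a category $\square(\mathcal{R})$ (called the cubicalization of $\mathcal{R}$) whose objects are those of $\mathcal{R}$, whose morphisms $r'\to r$ are the pairs $(\xi,f\gamma^\dagger)$ consisting of an $(\mathcal{R},\mathcal{R}^+_0)$-span $f\gamma^\dagger:r'\to r$ (a morphism of $\mathcal{V}(\mathcal{R})$) and an element $\xi\in\mathcal{R}^+_0/r$ with $\mathrm{im}(f)\wedge\xi=0$, and whose composition, for $(\xi,f\beta^\dagger):r'\to r$ and $(\zeta,g\gamma^\dagger):r\to r''$, is given by $$(\zeta,g\gamma^\dagger)\circ(\xi,f\beta^\dagger)=\bigl(\zeta\vee\omega,\ (\neg\omega)(\neg\omega)^\dagger\, g\gamma^\dagger f\beta^\dagger\bigr),\qquad \omega:=(g\gamma^\dagger)_\ast\xi=g_\ast\gamma^\ast\xi\in\mathcal{R}^+_0/r'' .$$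
   Context: For morphisms $u,v$ of a category, $u\pitchfork v$ means that every commutative square $va=bu$ has a diagonal filler $d$ ($du=a$, $vd=b$). A thin-powered structure on a small category $\mathcal{R}$ is a class $\mathcal{R}^+_0$ of morphisms such that: all its elements are monomorphisms; it is closed under composition; every morphism $f$ factors as $f=\delta\sigma$ with $\delta\in\mathcal{R}^+_0$ and $\sigma\in\mathcal{R}^-:=\{\sigma\mid\sigma\pitchfork\delta'\text{ for all }\delta'\in\mathcal{R}^+_0\}$, and this factorization is strictly unique; write $\mathrm{im}(f)=\delta$. Elements of $\mathcal{R}^+_0$ are called distinguished injections. (It follows that $\mathcal{R}^+_0$ is a wide subcategory whose only isomorphisms are identities, and that each slice category $\mathcal{R}^+_0/r$ is a poset with greatest element $\mathrm{id}_r$, where $\delta_1\le\delta_2$ iff $\delta_1=\delta_2\varepsilon$ with $\varepsilon\in\mathcal{R}^+_0$.) For $f:r\to r'$ put $f_\ast:\mathcal{R}^+_0/r\to\mathcal{R}^+_0/r'$, $f_\ast(\delta)=\mathrm{im}(f\delta)$. $\mathcal{R}$ is semicomplete if every pair $r'\xrightarrow{f}r\xleftarrow{\delta}s$ with $\delta\in\mathcal{R}^+_0$ has a pullback in $\mathcal{R}$; then there is a unique pullback square in which the projection to $r'$ lies in $\mathcal{R}^+_0$, and this projection is denoted $f^\ast\delta\in\mathcal{R}^+_0/r'$ (the map $f^\ast$ is right adjoint to $f_\ast$). $\mathcal{R}$ is stable if it is semicomplete and every pullback of a morphism of $\mathcal{R}^-$ along a distinguished injection is in $\mathcal{R}^-$;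 Boolean if it is semicomplete and every $\mathcal{R}^+_0/r$ is a Boolean lattice (operations $\wedge,\vee,\neg$, least element $0$, greatest element $1$); coherent if it is stable, every $\mathcal{R}^+_0/r$ is a lattice, and for every morphism $f$ the map $f^\ast$ preserves joins and the least element; locally finite if every $\mathcal{R}^+_0/r$ is finite. A small category $\mathcal{R}$ is cubicalizable if it has an initial object $0$ and is equipped with a locally finite, coherent, Boolean thin-powered structure such that for each $r$ the unique morphism $0\to r$ is a distinguished injection. $\mathcal{V}(\mathcal{R})$ is the category with the objects of $\mathcal{R}$ whose morphisms $x\to y$ are spans $x\xleftarrow{\gamma}a\xrightarrow{f}y$ in $\mathcal{R}$ with $\gamma\in\mathcal{R}^+_0$, written $f\gamma^\dagger$; composition is by pullback: $(g\delta^\dagger)(f\gamma^\dagger)=(gf')(\gamma\delta')^\dagger$, where $\delta'=f^\ast\delta$ and $f'$ is the other projection of the pullback of $f$ and $\delta$. For $\gamma:s\to r$ in $\mathcal{R}^+_0$ one has $\gamma^\dagger:r\to s$ in $\mathcal{V}(\mathcal{R})$; a morphism $f$ of $\mathcal{R}$ is identified with the span $f\,\mathrm{id}^\dagger$. For a span $f\gamma^\dagger:x\to y$ put $(f\gamma^\dagger)_\ast=f_\ast\gamma^\ast:\mathcal{R}^+_0/x\to\mathcal{R}^+_0/y$. *)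

(* Defs.v *)
From HB Require Import structures.
From mathcomp Require Import all_boot all_order.
From mathcomp Require Import boolp classical_sets functions cardinality.

Set Implicit Arguments.
Unset Strict Implicit.
Unset Printing Implicit Defensive.

Import Order.TTheory.
Local Open Scope order_scope.

Reserved Notation "g ∘ f" (at level 40, left associativity).

(** * Categories *)

Record categoryOn (O : Type) (H : O -> O -> Type) := CategoryOn {
  ident : forall x, H x x;
  compo : forall x y z, H y z -> H x y -> H x z;
  compoA : forall w x y z (h : H y z) (g : H x y) (f : H w x),
    compo h (compo g f) = compo (compo h g) f;
  compo_idl : forall x y (f : H x y), compo (ident y) f = f;
  compo_idr : forall x y (f : H x y), compo f (ident x) = f
}.

Record category := Category {
  obj :> Type;
  hom : obj -> obj -> Type;
  category_on :> categoryOn hom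
}.

Notation "g ∘ f" := (compo (category_on _) g f).

Section CategoryTheory.
Variable R : category.

Definition monic (x y : R) (f : hom x y) : Prop :=
  forall w (g h : hom w x), f ∘ g = f ∘ h -> g = h.

(* [lifts u v] is u ⋔ v *)
Definition lifts (x y x' y' : R) (u : hom x y) (v : hom x' y') : Prop :=
  forall (a : hom x x') (b : hom y y'), v ∘ a = b ∘ u ->
  exists d : hom y x', d ∘ u = a /\ v ∘ d = b.

Definition is_pullback (x y z w : R) (f : hom x z) (g : hom y z)
    (p : hom w x) (q : hom w y) : Prop :=
  f ∘ p = g ∘ q /\
  forall v (a : hom v x) (b : hom v y), f ∘ a = g ∘ b ->
  exists! u : hom v w, p ∘ u = a /\ q ∘ u = b.

Definition initial (o : R) : Prop :=
  forall x : R, exists! f : hom o x, True.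

End CategoryTheory.

(** * Thin-powered structures *)

Section Minus.
Variables (R : category) (D : forall x y : R, hom x y -> Prop).

Definition minus (x y : R) (s : hom x y) : Prop :=
  forall (u v : R) (d : hom u v), D d -> lifts s d.

(* The factorization [existT m (s, d)] is x --s--> m --d--> y.  Equality of
   such triples includes equality of the middle objects, which is the strict
   uniqueness required below. *)
Definition factorization (x y : R) := {m : R & (hom x m * hom m y)%type}.

Definition factors (x y : R) (f : hom x y) (t : factorization x y) : Prop :=
  [/\ minus (projT2 t).1, D (projT2 t).2 & f = (projT2 t).2 ∘ (projT2 t).1].

End Minus.

Record thinPowered (R : category) := ThinPowered {
  dinj : forall x y : R, hom x y -> Prop;
  dinj_monic : forall (x y : R) (d : hom x y), dinj d -> monic d;
  dinj_comp : forall (x y z : R) (d : hom x y) (e : hom y z),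
    dinj d -> dinj e -> dinj (e ∘ d);
  dinj_fact : forall (x y : R) (f : hom x y),
    exists! t : factorization x y, factors dinj f t
}.

(* [sub P r] is the set of objects of the slice of r: distinguished
   injections with codomain r. *)
Record sub (R : category) (P : thinPowered R) (r : R) := Sub {
  dom : R;
  inj : hom dom r;
  inj_dinj : dinj P inj
}.

Section Slice.
Variables (R : category) (P : thinPowered R).
Implicit Types r x y z : R.

Definition sub_le r (d1 d2 : sub P r) : Prop :=
  exists2 e : hom (dom d1) (dom d2), dinj P e & inj d1 = inj d2 ∘ e.

Lemma sub_eq r (d1 d2 : sub P r) :
  existT (fun m => hom m r) (dom d1) (inj d1) = existT _ (dom d2) (inj d2) ->
  d1 = d2.
Proof.
case: d1 d2 => [m1 f1 h1] [m2 f2 h2] /= E; move: h1 h2.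
pose Q (t : {m : R & hom m r}) :=
  forall (h1 : dinj P f1) (h2 : dinj P (projT2 t)), Sub h1 = Sub h2.
change (Q (existT _ m2 f2)); rewrite -E => h1 h2 /=.
by congr Sub; exact: Prop_irrelevance.
Qed.

Lemma minus_ident x : minus (@dinj R P) (ident R x).
Proof.
move=> u v d Dd a b E; exists a; split; first exact: compo_idr.
by rewrite E compo_idr.
Qed.

Lemma minus_iso x y (f : hom x y) (g : hom y x) :
  f ∘ g = ident R y -> g ∘ f = ident R x -> minus (@dinj R P) f.
Proof.
move=> fg gf u v d Dd a b E; exists (a ∘ g); split.
  by rewrite -compoA gf compo_idr.
by rewrite compoA E -compoA fg compo_idr.
Qed.

Lemma fact_uniq x y (f : hom x y) (t t' : factorization x y) :
  factors (@dinj R P) f t -> factors (@dinj R P) f t' -> t = t'.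
Proof. by case: (dinj_fact P f) => t0 [_ U] /U <- /U <-. Qed.

(* Distinguished injections have domains whose identities are distinguished. *)
Lemma dinj_ident_dom x y (d : hom x y) : dinj P d -> dinj P (ident R x).
Proof.
move=> Dd; case: (dinj_fact P (ident R x)) => -[m [s e]] [[/= ms De E] _].
have h1 : factors (@dinj R P) d (existT _ m (s, d ∘ e)).
  by split => //=; [exact: dinj_comp | rewrite -compoA -E compo_idr].
have h2 : factors (@dinj R P) d (existT _ x (ident R x, d)).
  by split => //=; [exact: minus_ident | rewrite compo_idr].
have /= F := fact_uniq h1 h2.
have : dinj P (projT2 (existT (fun m => hom x m * hom m x)%type m (s, e))).2 by [].
have K : (existT (fun m => hom x m * hom m x)%type m (s, e)) =
         (existT (fun m => hom x m * hom m x)%type x (ident R x, ident R x)).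
  pose Q (t : factorization x y) := forall e' : hom (projT1 t) x,
    ident R x = e' ∘ (projT2 t).1 ->
    existT (fun m => hom x m * hom m x)%type (projT1 t) ((projT2 t).1, e') =
    existT (fun m => hom x m * hom m x)%type x (ident R x, ident R x).
  suff : Q (existT _ m (s, d ∘ e)) by apply.
  by rewrite F => e' /=; rewrite compo_idr => <-.
by rewrite K.
Qed.

Lemma sub_le_refl r (d : sub P r) : sub_le d d.
Proof.
exists (ident R (dom d)); first exact: dinj_ident_dom (inj_dinj d).
by rewrite compo_idr.
Qed.

Lemma sub_le_trans r (d2 d1 d3 : sub P r) :
  sub_le d1 d2 -> sub_le d2 d3 -> sub_le d1 d3.
Proof.
move=> [e De Ee] [f Df Ef]; exists (f ∘ e); first exact: dinj_comp.
by rewrite compoA -Ef.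
Qed.

Lemma sub_le_anti r (d1 d2 : sub P r) :
  sub_le d1 d2 -> sub_le d2 d1 -> d1 = d2.
Proof.
move=> [e De Ee] [f Df Ef].
have ef : e ∘ f = ident R _.
  by apply: (dinj_monic (inj_dinj d2)); rewrite compoA -Ee -Ef compo_idr.
have fe : f ∘ e = ident R _.
  by apply: (dinj_monic (inj_dinj d1)); rewrite compoA -Ef -Ee compo_idr.
have h1 : factors (@dinj R P) (inj d1) (existT _ (dom d1) (ident R _, inj d1)).
  by split => /=; [exact: minus_ident | exact: inj_dinj | rewrite compo_idr].
have h2 : factors (@dinj R P) (inj d1) (existT _ (dom d2) (e, inj d2)).
  by split => //=; [exact: minus_iso ef fe | exact: inj_dinj].
apply: sub_eq; have := fact_uniq h1 h2.
exact: (congr1 (fun t : factorization (dom d1) r =>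
                  existT (fun m => hom m r) (projT1 t) (projT2 t).2)).
Qed.

End Slice.

HB.instance Definition _ (R : category) (P : thinPowered R) (r : R) :=
  gen_eqMixin (sub P r).
HB.instance Definition _ (R : category) (P : thinPowered R) (r : R) :=
  gen_choiceMixin (sub P r).

Fact sub_display : Order.disp_t. Proof. exact: Order.Disp tt tt. Qed.

Section SliceOrder.
Variables (R : category) (P : thinPowered R) (r : R).

Let le (d1 d2 : sub P r) : bool := `[< sub_le d1 d2 >].

Let le_refl : reflexive le.
Proof. by move=> d; apply/asboolP/sub_le_refl. Qed.

Let le_anti : antisymmetric le.
Proof. by move=> d1 d2 /andP[/asboolP h1 /asboolP h2]; exact: sub_le_anti. Qed.

Let le_trans : transitive le.
Proof.
by move=> d2 d1 d3 /asboolP h1 /asboolP h2; apply/asboolP/(sub_le_trans h1).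
Qed.

HB.instance Definition _ := Order.Le_isPOrder.Build sub_display (sub P r)
  le_refl le_anti le_trans.

End SliceOrder.

Section Image.
Variables (R : category) (P : thinPowered R).
Implicit Types r x y z : R.

Lemma fact_ex x y (f : hom x y) : exists t, factors (@dinj R P) f t.
Proof. by case: (dinj_fact P f) => t [? _]; exists t. Qed.

Definition im x y (f : hom x y) : sub P y :=
  let t := cid (fact_ex f) in
  let: And3 _ D _ := projT2 t in Sub D.

(* f_* *)
Definition pushf x y (f : hom x y) (d : sub P x) : sub P y := im (f ∘ inj d).

Definition semicomplete : Prop :=
  forall x y z (f : hom x y) (d : hom z y), dinj P d ->
  exists w (p : hom w x) (q : hom w z), is_pullback f d p q.

(* Pullbacks of f along a distinguished injection d, with distinguished
   projection to the domain of f.  They exist by dpullback_ex below, and are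
   unique since a distinguished isomorphism between domains of distinguished
   injections is an identity, so that the choice made in dpull is immaterial. *)
Record dpullback x y (f : hom x y) (d : sub P y) := DPullback {
  dp_sub : sub P x;
  dp_proj : hom (dom dp_sub) (dom d);
  dp_pullback : is_pullback f (inj d) (inj dp_sub) dp_proj
}.

Lemma dpullback_ex (sc : semicomplete) x y (f : hom x y) (d : sub P y) :
  exists t : dpullback f d, True.
Proof.
case: d => z d Dd; have [w [p [q [E U]]]] := sc _ _ _ f d Dd.
case: (dinj_fact P p) => -[m [s e]] [[/= ms De Ep] _].
have [|k [ks dk]] := ms _ _ d Dd q (f ∘ e).
  by rewrite -E Ep compoA.
have [u [[pu qu] _]] := U m e k (esym dk).
have us : u ∘ s = ident R w.
  have [v [_ V]] := U w p q E.
  rewrite -(V (u ∘ s)) ?(V (ident R w)) //.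
    by rewrite !compo_idr.
  by rewrite !compoA pu qu ks.
have su : s ∘ u = ident R m.
  by apply: (dinj_monic De); rewrite compoA -Ep pu compo_idr.
suff h : is_pullback f (inj (Sub Dd)) (inj (Sub De)) k by exists (DPullback h).
split => /= [|v a b /U [t [[pt qt] V]]]; first by [].
exists (s ∘ t); split; first by rewrite !compoA -Ep ks.
by move=> t' [et' _]; apply: (dinj_monic De); rewrite compoA -Ep pt et'.
Qed.

Definition dpull (sc : semicomplete) x y (f : hom x y) (d : sub P y) :
  dpullback f d := projT1 (cid (dpullback_ex sc f d)).

(* f^* *)
Definition pullf (sc : semicomplete) x y (f : hom x y) (d : sub P y) : sub P x :=
  dp_sub (dpull sc f d).

End Image.

(** * Order-theoretic notions *)

Section OrderNotions.
Context {disp : Order.disp_t} {T : porderType disp}.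

Definition is_glb (a b m : T) : Prop :=
  forall c, (c <= m) = (c <= a) && (c <= b).

Definition is_lub (a b j : T) : Prop :=
  forall c, (j <= c) = (a <= c) && (b <= c).

Definition is_least (b : T) : Prop := forall c, b <= c.

End OrderNotions.

Definition lattice_order disp (T : porderType disp) : Prop :=
  forall a b : T, (exists m, is_glb a b m) /\ (exists j, is_lub a b j).

Record booleanOps disp (T : porderType disp) := BooleanOps {
  bmeet : T -> T -> T;
  bjoin : T -> T -> T;
  bcompl : T -> T;
  bbot : T;
  btop : T;
  bmeetP : forall a b, is_glb a b (bmeet a b);
  bjoinP : forall a b, is_lub a b (bjoin a b);
  bbotP : is_least bbot;
  btopP : forall a, a <= btop;
  bmeetUl : left_distributive bmeet bjoin;
  bmeetC : forall a, bmeet a (bcompl a) = bbot;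
  bjoinC : forall a, bjoin a (bcompl a) = btop
}.

Definition boolean_order disp (T : porderType disp) : Prop :=
  exists _ : booleanOps T, True.

(** * Cubicalizable categories *)

Section Cubicalizable.
Variables (R : category) (P : thinPowered R).

Record stable : Prop := Stable {
  stable_semicomplete :> semicomplete P;
  stable_minus : forall (w x y z : R)
    (f : hom x y) (d : hom z y) (p : hom w x) (q : hom w z),
    minus (@dinj R P) f -> dinj P d -> is_pullback f d p q ->
    minus (@dinj R P) q
}.

Record boolean : Prop := Boolean {
  boolean_semicomplete :> semicomplete P;
  boolean_sub : forall r : R, boolean_order (sub P r)
}.

Record coherent : Prop := Coherent {
  coherent_stable :> stable;
  coherent_lattice : forall r : R, lattice_order (sub P r);
  coherent_least : forall r : R, exists b : sub P r, is_least b;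
  coherent_join : forall (x y : R) (f : hom x y) (a b j : sub P y),
    is_lub a b j -> is_lub (pullf coherent_stable f a)
                           (pullf coherent_stable f b)
                           (pullf coherent_stable f j);
  coherent_bot : forall (x y : R) (f : hom x y) (b : sub P y),
    is_least b -> is_least (pullf coherent_stable f b)
}.

Definition locally_finite : Prop :=
  forall r : R, finite_set [set: sub P r].

Record cubicalizable : Prop := Cubicalizable {
  cub_initial : exists2 o : R, initial o &
    forall (r : R) (f : hom o r), dinj P f;
  cub_finite : locally_finite;
  cub_coherent :> coherent;
  cub_boolean : boolean
}.

End Cubicalizable.

(* The slices of a cubicalizable category, with the notations
   `&`, `|`, ~`, \bot, \top of Boolean lattices. *)
Definition bsub (R : category) (P : thinPowered R) (K : cubicalizable P) (r : R)
  : Type := sub P r.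

Section BooleanSlice.
Variables (R : category) (P : thinPowered R) (K : cubicalizable P) (r : R).

HB.instance Definition _ := Order.POrder.on (bsub K r).

Let ops : booleanOps (bsub K r) :=
  projT1 (cid (boolean_sub (cub_boolean K) r)).

Let meetP (x y z : bsub K r) : (x <= bmeet ops y z) = (x <= y) && (x <= z).
Proof. exact: bmeetP. Qed.

Let joinP (x y z : bsub K r) : (bjoin ops x y <= z) = (x <= z) && (y <= z).
Proof. exact: bjoinP. Qed.

HB.instance Definition _ :=
  Order.POrder_MeetJoin_isLattice.Build sub_display (bsub K r) meetP joinP.

HB.instance Definition _ :=
  Order.Lattice_Meet_isDistrLattice.Build sub_display (bsub K r) (@bmeetUl _ _ ops).

HB.instance Definition _ :=
  Order.hasBottom.Build sub_display (bsub K r) (bbotP ops).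

HB.instance Definition _ :=
  Order.hasTop.Build sub_display (bsub K r) (btopP ops).

HB.instance Definition _ :=
  Order.TBDistrLattice_hasComplement.Build sub_display (bsub K r)
    (@bjoinC _ _ ops) (@bmeetC _ _ ops).

End BooleanSlice.

(** * Spans *)

Section Spans.
Variables (R : category) (P : thinPowered R).

(* The span f γ^† is x <--γ-- a --f--> y.  An isomorphism of spans is an
   identity, as it factors one left leg through the other, so spans are
   compared strictly. *)
Record span (x y : R) := Span {
  left_leg : sub P x;
  right_leg : hom (dom left_leg) y
}.

Definition sub_comp (x : R) (c : sub P x) (d : sub P (dom c)) : sub P x :=
  Sub (dinj_comp (inj_dinj d) (inj_dinj c)).

(* (g δ^†)(f γ^†) = (g f')(γ δ')^† *)
Definition span_comp (sc : semicomplete P) (x y z : R)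
    (v : span y z) (u : span x y) : span x z :=
  let t := dpull sc (right_leg u) (left_leg v) in
  @Span x z (sub_comp (dp_sub t)) (right_leg v ∘ dp_proj t).

(* (f γ^†)_* = f_* γ^* *)
Definition span_push (sc : semicomplete P) (x y : R) (u : span x y)
    (d : sub P x) : sub P y :=
  pushf (right_leg u) (pullf sc (inj (left_leg u)) d).

(* δ δ^† *)
Definition span_sub (r : R) (d : sub P r) : span r r := Span (inj d).

End Spans.

(** * The morphisms of the cubicalization *)

Record cube_hom (R : category) (P : thinPowered R) (K : cubicalizable P)
    (x y : R) := CubeHom {
  cube_sub : bsub K y;
  cube_span : span P x y;
  cube_disj : (im P (right_leg cube_span) : bsub K y) `&` cube_sub = \bot
}.

(* Main.v *)
Require Import Defs.
From mathcomp Require Import all_boot all_order.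
From mathcomp Require Import boolp.

(** The argument runs through generalized elements.  A subobject [d] of [r] is
    known by the morphisms [a] into [r] that factor through it ([thru d a]); a
    span from [x] to [y] is known by the relation [rel] it induces between
    morphisms [w -> x] and [w -> y] with a common source.  Both descriptions
    are faithful ([thru_le], [span_ext]), because a distinguished isomorphism
    between subobjects is an identity.  The universal property of the pullback
    says precisely that spans compose as relations ([rel_comp]), so that the
    category laws of spans are those of relations.  The identity span on [x] is
    carried by the greatest subobject of [x].

    The link with the Boolean structure is a Kripke-style reading of
    implication ([thru_impl]): [b] lies in [~` A `|` B] as soon as every
    restriction [b ∘ k] that lies in [A] lies in [B].  This is where inverse
    images preserving joins is used; negation is the case [B = \bot].  It yields
    a right adjoint of the direct image along a span, a weakest precondition
    ([span_wp]), whence direct images preserve joins and the least element and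
    are functorial in the span.

    With [ω] and [τ] the direct images under [w] of the subobject of [v], and
    under [w v] of the subobject of [u], the two bracketings of a triple
    composite have [ω `|` (~` ω `&` τ)] and [ω `|` τ], joined with the
    subobject of [w], as their first components; these agree in a Boolean
    algebra.  The second components both restrict [w v u] to values outside
    [ω `|` τ]; one of them also demands that the intermediate value under
    [v u] avoid a subobject [α] with direct image [τ] under [w], and this
    demand holds by itself: an intermediate value inside [α] would be sent into
    [τ] ([rel_avoid]). *)

Set Implicit Arguments.
Unset Strict Implicit.
Unset Printing Implicit Defensive.

Import Order.Theory.
Local Open Scope order_scope.

(** * Generalized elements of subobjects *)

Section Elements.
Variables (R : category) (P : thinPowered R).
Implicit Types x y z w r : R.

Definition thru r (d : sub P r) w (a : hom w r) : Prop :=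
  exists h : hom w (dom d), inj d ∘ h = a.

Lemma thru_comp r (d : sub P r) w (a : hom w r) v (k : hom v w) :
  thru d a -> thru d (a ∘ k).
Proof. by case=> h <-; exists (h ∘ k); rewrite compoA. Qed.

Lemma thru_inj r (d : sub P r) : thru d (inj d).
Proof. by exists (ident R _); rewrite compo_idr. Qed.

(** Factoring [h] as [e ∘ s] gives [d ∘ h] the two factorizations [(s, d ∘ e)]
    and [(ident, d ∘ h)], which must coincide; hence [s] is an identity. *)
Lemma dinj_cancel x y z (d : hom y z) (h : hom x y) :
  dinj P d -> dinj P (d ∘ h) -> dinj P h.
Proof.
move=> Dd Ddh; case: (dinj_fact P h) => -[m [s e]] [[/= ms De Eh] _].
have h1 : factors (@dinj R P) (d ∘ h) (existT _ m (s, d ∘ e)).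
  by split=> //=; [exact: dinj_comp | rewrite Eh compoA].
have h2 : factors (@dinj R P) (d ∘ h) (existT _ x (ident R x, d ∘ h)).
  by split=> //=; [exact: minus_ident | rewrite compo_idr].
(* The equality of factorizations is transported along the predicate below,
   as the middle objects are only propositionally equal. *)
pose Q (t : factorization x z) := forall e' : hom (projT1 t) y,
  dinj P e' -> dinj P (e' ∘ (projT2 t).1).
suff /(_ e De) : Q (existT _ m (s, d ∘ e)) by rewrite -Eh.
by rewrite (fact_uniq h1 h2) => e' De' /=; rewrite compo_idr.
Qed.

Lemma sub_leP r (d1 d2 : sub P r) : reflect (sub_le d1 d2) (d1 <= d2).
Proof. exact: asboolP. Qed.

Lemma le_thru r (d1 d2 : sub P r) : d1 <= d2 <-> thru d2 (inj d1).
Proof.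
split=> [/sub_leP[e _ E]|[h E]]; first by exists e.
apply/sub_leP; exists h => //.
by apply: dinj_cancel (inj_dinj d2) _; rewrite E; exact: inj_dinj.
Qed.

Lemma thru_le r (d1 d2 : sub P r) :
  d1 <= d2 <-> forall w (a : hom w r), thru d1 a -> thru d2 a.
Proof.
rewrite le_thru; split=> [t w a [h <-]|]; first exact: thru_comp.
by apply; exact: thru_inj.
Qed.

(** The diagonal filler of the [minus] part of [f] against [d] is the
    comparison of the image of [f] with [d]. *)
Lemma thru_im x y (f : hom x y) (d : sub P y) : thru d f <-> im P f <= d.
Proof.
rewrite le_thru /im /=; case: (svalP _) => /=; case: (cid _) => -[m [s e]] /= _ ms De Ef.
split=> [[h Eh]|[h Eh]].
  have [k [_ dk]] := ms _ _ _ (inj_dinj d) h e (etrans Eh Ef).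
  by exists k.
by exists (h ∘ s); rewrite compoA Eh.
Qed.

Lemma le_pushf x y (f : hom x y) (d : sub P x) (e : sub P y) :
  pushf f d <= e <-> forall w (a : hom w x), thru d a -> thru e (f ∘ a).
Proof.
rewrite -thru_im; split=> [t w a [h <-]|]; last by apply; exact: thru_inj.
by rewrite compoA; exact: thru_comp.
Qed.

Lemma thru_pullf (sc : semicomplete P) x y (f : hom x y) (d : sub P y)
    w (a : hom w x) :
  thru (pullf sc f d) a <-> thru d (f ∘ a).
Proof.
rewrite /pullf; case: (dpull sc f d) => p q [/= E U].
split=> [[h <-]|[h Eh]].
  by exists (q ∘ h); rewrite !compoA E.
by have [u [[pu _] _]] := U _ a h (esym Eh); exists u.
Qed.

End Elements.

(** * Spans as relations *)

Section Relations.
Variables (R : category) (P : thinPowered R).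
Implicit Types x y z w r : R.

Definition rel x y (u : span P x y) w (a : hom w x) (b : hom w y) : Prop :=
  exists2 h, inj (left_leg u) ∘ h = a & right_leg u ∘ h = b.

Lemma rel_restr x y (u : span P x y) w (a : hom w x) (b : hom w y)
    v (k : hom v w) :
  rel u a b -> rel u (a ∘ k) (b ∘ k).
Proof. by case=> h <- <-; exists (h ∘ k); rewrite compoA. Qed.

Lemma rel_legs x y (u : span P x y) : rel u (inj (left_leg u)) (right_leg u).
Proof. by exists (ident R _); rewrite compo_idr. Qed.

(** Each span relates its own legs; two spans with the same relation therefore
    factor through each other, so that their left legs are equal subobjects. *)
Lemma span_ext x y (u v : span P x y) :
  (forall w (a : hom w x) (b : hom w y), rel u a b <-> rel v a b) -> u = v.
Proof.
move=> E; have /E[h ch fh] := rel_legs u; have /E[k ck _] := rel_legs v.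
case: u v {E} h ch fh k ck => [c f] [d g] /= h ch fh k ck.
have E : c = d by apply/le_anti/andP; split; apply/le_thru; [exists h|exists k].
case: _ / E g h k ch fh {ck} => g h _ ch <-.
have -> : h = ident R _; last by rewrite compo_idr.
by apply: (dinj_monic (inj_dinj c)); rewrite ch compo_idr.
Qed.

Lemma rel_comp (sc : semicomplete P) x y z (v : span P y z) (u : span P x y)
    w (a : hom w x) (c : hom w z) :
  rel (span_comp sc v u) a c <-> exists2 b, rel u a b & rel v b c.
Proof.
rewrite /span_comp; case: (dpull sc _ _) => p q [/= E U].
split=> [[/= h <- <-]|[b [k <- Ek] [l El <-]]].
  exists (right_leg u ∘ (inj p ∘ h)); first by exists (inj p ∘ h); rewrite ?compoA.
  by exists (q ∘ h); rewrite !compoA ?E.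
have [h [[ph qh] _]] := U _ k l (etrans Ek (esym El)).
by exists h => /=; rewrite -!compoA ?ph ?qh.
Qed.

Lemma rel_sub r (d : sub P r) w (a b : hom w r) :
  rel (span_sub d) a b <-> a = b /\ thru d a.
Proof. by split=> [[h <- <-]|[<- [h Eh]]]; [split; last exists h | exists h]. Qed.

Lemma le_span_push (sc : semicomplete P) x y (u : span P x y) (d : sub P x)
    (e : sub P y) :
  span_push sc u d <= e <->
  forall w (a : hom w x) (b : hom w y), thru d a -> rel u a b -> thru e b.
Proof.
rewrite le_pushf; split=> [H w a b da [h Ea <-]|H w h /thru_pullf dh].
  by apply/H/thru_pullf; rewrite Ea.
by apply: H dh _; exists h.
Qed.

Lemma rel_push (sc : semicomplete P) x y (u : span P x y) (d : sub P x)
    w (a : hom w x) (b : hom w y) :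
  thru d a -> rel u a b -> thru (span_push sc u d) b.
Proof. by move: w a b; apply/le_span_push. Qed.

End Relations.

(** * Elements and Boolean operations *)

Section Boolean.
Variables (R : category) (P : thinPowered R) (K : cubicalizable P).
Implicit Types x y z w r : R.

Lemma thru_imb r (d : bsub K r) w (a : hom w r) :
  thru d a <-> (im P a : bsub K r) <= d.
Proof. exact: thru_im. Qed.

Lemma thru_leb r (d e : bsub K r) w (a : hom w r) :
  d <= e -> thru d a -> thru e a.
Proof. by move/thru_le; apply. Qed.

Lemma thru_top r w (a : hom w r) : thru (\top : bsub K r) a.
Proof. by apply/thru_imb; exact: lex1. Qed.

Lemma thru_meet r (d e : bsub K r) w (a : hom w r) :
  thru (d `&` e) a <-> thru d a /\ thru e a.
Proof. by rewrite !thru_imb lexI; split=> [/andP|[-> ->]]. Qed.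

(** The least subobject is stable under inverse image, so a morphism factors
    through it only if its source is degenerate: the least subobject of the
    source is then the greatest. *)
Lemma thru_bot r s w (a : hom w r) (b : hom w s) :
  thru (\bot : bsub K r) a -> thru (\bot : bsub K s) b.
Proof.
rewrite -(compo_idr R a) -(compo_idr R b) => /(thru_pullf K) t.
apply/(thru_pullf K); move: t; apply: (proj1 (thru_le _ _)).
apply: (coherent_bot K a (b := (\bot : bsub K r))) => c.
exact: (le0x (c : bsub K _)).
Qed.

(** The inverse images of [A] and [~` A] along [b] cover the source of [b].
    The first lies in that of [B] by hypothesis, so the inverse image of
    [~` A `|` B] is everything. *)
Lemma thru_impl r (A B : bsub K r) w (b : hom w r) :
  thru (~` A `|` B) b <->
  forall v (k : hom v w), thru A (b ∘ k) -> thru B (b ∘ k).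
Proof.
split=> [t v k tA|H].
  have: thru (A `&` (~` A `|` B)) (b ∘ k).
    by apply/thru_meet; split=> //; exact: thru_comp.
  by apply: thru_leb; rewrite meetUr meetxC join0x leIr.
have lubU (C D : bsub K r) : is_lub C D (C `|` D) by move=> e; exact: leUx.
have coverA := coherent_join K b (lubU A (~` A)).
have coverB := coherent_join K b (lubU (~` A) B).
have := coverB (pullf K b (~` A `|` B)); rewrite lexx => /esym/andP[leC leB].
have leA : pullf K b A <= pullf K b (~` A `|` B).
  apply: le_trans leB; apply/thru_le => v k /thru_pullf/H tB.
  by apply/thru_pullf.
have : pullf K b (A `|` ~` A) <= pullf K b (~` A `|` B) by rewrite coverA leA.
rewrite joinxC => /thru_le/(_ _ (ident R w)).
by rewrite !thru_pullf compo_idr; apply; exact: thru_top.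
Qed.

Lemma thru_compl r (A : bsub K r) w (b : hom w r) :
  thru (~` A) b <->
  forall v (k : hom v w), thru A (b ∘ k) -> thru (\bot : bsub K r) (b ∘ k).
Proof. by rewrite -[~` A]joinx0; exact: thru_impl. Qed.

(** * Direct images along spans *)

Definition span_pre x y (u : span P x y) (e : sub P y) : bsub K x :=
  sub_comp (pullf K (right_leg u) e).

(** A weakest precondition: outside its left leg the span relates nothing, so
    there the condition on the values holds vacuously. *)
Definition span_wp x y (u : span P x y) (e : sub P y) : bsub K x :=
  ~` (left_leg u : bsub K x) `|` span_pre u e.

(** [span_push] with its values typed in the Boolean slices, so that the lattice
    operations apply to them. *)
Definition bpush x y (u : span P x y) (d : bsub K x) : bsub K y :=
  span_push K u d.

Lemma thru_wp x y (u : span P x y) (e : sub P y) w (b : hom w x) :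
  thru (span_wp u e) b <->
  forall v (k : hom v w) (c : hom v y), rel u (b ∘ k) c -> thru e c.
Proof.
rewrite thru_impl; split=> H v k.
  move=> c [h Eb Ec]; have [|l] := H v k; first by exists h.
  rewrite /= -Eb -compoA => /(dinj_monic (inj_dinj (left_leg u))) Eh.
  by rewrite -Ec; apply/(thru_pullf K); exists l.
case=> h Eb; have /(thru_pullf K)[l El] : thru e (right_leg u ∘ h).
  by apply: (H v k); exists h.
by exists l; rewrite /= -compoA El.
Qed.

Lemma bpush_wp x y (u : span P x y) (d : bsub K x) (e : bsub K y) :
  bpush u d <= e <-> d <= span_wp u e.
Proof.
rewrite (le_span_push K) (thru_le d); split=> H w a.
  by move=> da; apply/thru_wp => v k c; apply: H; exact: thru_comp.
move=> b /H/thru_wp/(_ _ (ident R w)); rewrite compo_idr; exact.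
Qed.

Lemma bpushU x y (u : span P x y) (d e : bsub K x) :
  bpush u (d `|` e) = bpush u d `|` bpush u e.
Proof.
apply/le_anti/andP; split; last rewrite leUx.
  apply/bpush_wp; rewrite leUx.
  by apply/andP; split; apply/bpush_wp; rewrite ?leUl ?leUr.
have unit_wp : d `|` e <= span_wp u (bpush u (d `|` e)) by apply/bpush_wp.
by apply/andP; split; apply/bpush_wp; apply: le_trans unit_wp;
  rewrite ?leUl ?leUr.
Qed.

Lemma bpush0 x y (u : span P x y) : bpush u \bot = \bot.
Proof. by apply/eqP; rewrite -lex0; apply/bpush_wp; exact: le0x. Qed.

(** The nontrivial inequality says that a value of [v] at any element of
    [bpush u d], not only at one reached by [u], lies in the direct image along
    the composite.  Transposing to the precondition of [v] reduces it to the
    elements that [u] reaches. *)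
Lemma bpush_comp x y z (v : span P y z) (u : span P x y) (d : bsub K x) :
  bpush (span_comp K v u) d = bpush v (bpush u d).
Proof.
apply/le_anti/andP; split.
  apply/(le_span_push K) => w a c da /(rel_comp K)[b ab bc].
  by apply: (rel_push K _ bc); exact: rel_push da ab.
apply/bpush_wp/(le_span_push K) => w a b da ab; apply/thru_wp => t k c bc.
apply: (rel_push K (thru_comp k da)); apply/rel_comp.
by exists (b ∘ k) => //; exact: rel_restr.
Qed.

Lemma bpush_sub r (p d : bsub K r) : bpush (span_sub p) d = p `&` d.
Proof.
apply/le_anti/andP; split.
  apply/(le_span_push K) => w a b da /rel_sub[<- pa].
  by apply/thru_meet.
apply/thru_le => w a /thru_meet[pa da].
by apply: (rel_push K da); apply/rel_sub.
Qed.

(** A restriction [a ∘ k] lying in [alpha] would place [b ∘ k] in the direct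
    image of [alpha], which [b] avoids; so the source of [k] is degenerate. *)
Lemma rel_avoid x y (u : span P x y) (alpha : bsub K x)
    w (a : hom w x) (b : hom w y) :
  rel u a b -> thru (~` bpush u alpha) b -> thru (~` alpha) a.
Proof.
move=> ab /thru_compl nb; apply/thru_compl => v k ak.
apply: (thru_bot _ (nb _ k _)).
exact: rel_push ak (rel_restr k ab).
Qed.

End Boolean.

(** * The cubicalization *)

Section Cubes.
Variables (R : category) (P : thinPowered R) (K : cubicalizable P).
Implicit Types x y z w r : R.

Lemma cube_ext x y (u v : cube_hom K x y) :
  cube_sub u = cube_sub v -> cube_span u = cube_span v -> u = v.
Proof.
case: u v => [xi f p] [ze g q] /= E F; case: _ / E q => q; case: _ / F q => q.
by congr CubeHom; exact: Prop_irrelevance.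
Qed.

Lemma span_disj x y (u : span P x y) (xi : bsub K y) :
  (im P (right_leg u) : bsub K y) `&` xi = \bot <->
  forall w (a : hom w x) (b : hom w y), rel u a b -> thru (~` xi) b.
Proof.
split=> [/eqP|H]; last first.
  by apply/eqP; rewrite disj_leC; apply/thru_imb; exact: H (rel_legs u).
by rewrite disj_leC => /thru_imb t w a b [h _ <-]; exact: thru_comp.
Qed.

Lemma cube_avoid x y (u : cube_hom K x y) w (a : hom w x) (b : hom w y) :
  rel (cube_span u) a b -> thru (~` cube_sub u) b.
Proof. by move: w a b; apply/span_disj; exact: cube_disj. Qed.

Lemma cube_id_disj x :
  (im P (right_leg (span_sub (\top : bsub K x))) : bsub K x) `&` \bot = \bot.
Proof. exact: meetx0. Qed.

Definition cube_id x : cube_hom K x x := CubeHom (cube_id_disj x).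

(** Every morphism into [x] factors through the greatest subobject, which is
    thus carried by an isomorphism.  Its span serves as the identity, whether
    or not [ident R x] itself is distinguished. *)
Lemma rel_id x w (a b : hom w x) :
  rel (span_sub (\top : bsub K x)) a b <-> a = b.
Proof. by rewrite rel_sub; split=> [[]|->] //; split=> //; exact: thru_top. Qed.

Definition cube_comp_sub x y z (v : cube_hom K y z) (u : cube_hom K x y) :
    bsub K z :=
  cube_sub v `|` bpush (cube_span v) (cube_sub u).

Definition cube_comp_span x y z (v : cube_hom K y z) (u : cube_hom K x y) :
    span P x z :=
  span_comp K (span_sub (~` bpush (cube_span v) (cube_sub u)))
    (span_comp K (cube_span v) (cube_span u)).

Lemma rel_cube_comp x y z (v : cube_hom K y z) (u : cube_hom K x y)
    w (a : hom w x) (c : hom w z) :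
  rel (cube_comp_span v u) a c <->
  thru (~` bpush (cube_span v) (cube_sub u)) c /\
  exists2 b, rel (cube_span u) a b & rel (cube_span v) b c.
Proof.
rewrite rel_comp; split=> [[c' /rel_comp ? /rel_sub[<-]]|[t /(rel_comp K) ac]] //.
by exists c => //; apply/rel_sub.
Qed.

Lemma cube_comp_disj x y z (v : cube_hom K y z) (u : cube_hom K x y) :
  (im P (right_leg (cube_comp_span v u)) : bsub K z) `&` cube_comp_sub v u = \bot.
Proof.
apply/span_disj => w a c /rel_cube_comp[t [b _ /cube_avoid bc]].
by rewrite complU; apply/thru_meet.
Qed.

Definition cube_comp x y z (v : cube_hom K y z) (u : cube_hom K x y) :
  cube_hom K x z := CubeHom (cube_comp_disj v u).

Lemma cube_compA w x y z (h : cube_hom K y z) (g : cube_hom K x y)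
    (f : cube_hom K w x) :
  cube_comp h (cube_comp g f) = cube_comp (cube_comp h g) f.
Proof.
have pushE : bpush (cube_comp_span h g) (cube_sub f) =
    ~` bpush (cube_span h) (cube_sub g) `&`
    bpush (cube_span h) (bpush (cube_span g) (cube_sub f)).
  by rewrite bpush_comp bpush_sub bpush_comp.
apply: cube_ext => /=.
  rewrite /cube_comp_sub /= pushE /cube_comp_sub bpushU joinA joinIr.
  by rewrite -[X in X `&` _]joinA joinxC joinx1 meet1x.
apply: span_ext => t a d; rewrite !rel_cube_comp /= pushE /cube_comp_sub bpushU.
rewrite complU complI complK !thru_meet; split.
  case=> -[nom ntau] [c /rel_cube_comp[_ [b ab bc]] cd]; split.
    by apply: thru_leb ntau; exact: leUr.
  by exists b => //; apply/rel_cube_comp; split=> //; exists c.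
case=> t1 [b ab /rel_cube_comp[nom [c bc cd]]].
have ntau : thru (~` bpush (cube_span h) (bpush (cube_span g) (cube_sub f))) d.
  have : thru (~` bpush (cube_span h) (cube_sub g) `&`
     (bpush (cube_span h) (cube_sub g) `|`
      ~` bpush (cube_span h) (bpush (cube_span g) (cube_sub f)))) d.
    by apply/thru_meet.
  by apply: thru_leb; rewrite meetUr meetCx join0x leIr.
split=> //; exists c => //; apply/rel_cube_comp; split; last by exists b.
exact: rel_avoid cd ntau.
Qed.

Lemma cube_comp_idl x y (f : cube_hom K x y) : cube_comp (cube_id y) f = f.
Proof.
apply: cube_ext => /=.
  by rewrite /cube_comp_sub /= bpush_sub meet1x join0x.
apply: span_ext => w a b; rewrite rel_cube_comp /= bpush_sub meet1x.
split=> [[_ [b' ab /rel_id <-]]|ab] //; split; first exact: cube_avoid ab.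
by exists b => //; apply/rel_id.
Qed.

Lemma cube_comp_idr x y (f : cube_hom K x y) : cube_comp f (cube_id x) = f.
Proof.
apply: cube_ext => /=; first by rewrite /cube_comp_sub /= bpush0 joinx0.
apply: span_ext => w a b; rewrite rel_cube_comp /= bpush0 compl0.
split=> [[_ [a' /rel_id <-]]|ab] //; split; first exact: thru_top.
by exists a => //; apply/rel_id.
Qed.

End Cubes.

Theorem proposition7p10 (R : category) (P : thinPowered R)
    (K : cubicalizable P) :
  exists C : categoryOn (cube_hom K),
    forall (r' r r'' : R) (u : cube_hom K r' r) (v : cube_hom K r r''),
    let omega : bsub K r'' := span_push K (cube_span v) (cube_sub u) in
    cube_sub (compo C v u) = cube_sub v `|` omega /\
    cube_span (compo C v u) =
      span_comp K (span_sub (~` omega))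
        (span_comp K (cube_span v) (cube_span u)).
Proof.
by exists (CategoryOn (@cube_compA R P K) (@cube_comp_idl R P K)
  (@cube_comp_idr R P K)).
Qed.
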